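(* Let $p>1$. Then: (1) $L(1/\sin_p(x),1/\sin_p(y))\geq 1/\sin_p(A(x,y))$ for all $x,y\in(0,\pi_p/2)$; (2) $L(1/\cos_p(x),1/\cos_p(y))\geq 1/\cos_p(L(x,y))$ for all $x,y\in(0,\pi_p/2)$; (3) $L(\tanh_p(x),\tanh_p(y))\leq \tanh_p(A(x,y))$ for all $x,y\in(0,\infty)$; (4) $L(\operatorname{arcsinh}_p(x),\operatorname{arcsinh}_p(y))\leq \operatorname{arcsinh}_p(A(x,y))$ for all $x,y\in(0,1)$; (5) $L(\arctan_p(x),\arctan_p(y))\leq \arctan_p(A(x,y))$ for all $x,y\in(0,1)$.
   Context: For $p>1$, let $\arcsin_p(x)=\int_0^x(1-t^p)^{-1/p}\,dt$ for $x\in[0,1]$, and $\pi_p=2\arcsin_p(1)=\frac{2\pi}{p\sin(\pi/p)}$. The function $\sin_p:[0,\pi_p/2]\to[0,1]$ is the inverse of $\arcsin_p$, and $\cos_p(x)=\frac{d}{dx}\sin_p(x)=(1-\sin_p(x)^p)^{1/p}$ for $x\in[0,\pi_p/2]$. Let $\operatorname{arcsinh}_p(x)=\int_0^x(1+t^p)^{-1/p}\,dt$ for $x\in(0,\infty)$; $\sinh_p:(0,\infty)\to(0,\infty)$ is its inverse function, $\cosh_p(x)=\frac{d}{dx}\sinh_p(x)$ (so that $\cosh_p(x)^p-\sinh_p(x)^p=1$), and $\tanh_p(x)=\sinh_p(x)/\cosh_p(x)$. Let $\arctan_p(x)=\int_0^x(1+t^p)^{-1}\,dt$ for $x\in(0,1)$.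 For positive reals $a\neq b$, $A(a,b)=\frac{a+b}{2}$ is the arithmetic mean and $L(a,b)=\frac{a-b}{\log a-\log b}$ is the logarithmic mean; by convention $A(a,a)=L(a,a)=a$. *)

(* Defs.v *)
From HB Require Import structures.
From mathcomp Require Import all_boot all_order all_algebra.
From mathcomp Require Import all_classical all_reals all_analysis.

Set Implicit Arguments.
Unset Strict Implicit.
Unset Printing Implicit Defensive.

Import Order.TTheory GRing.Theory Num.Theory.
Import numFieldNormedType.Exports.

Local Open Scope classical_set_scope.
Local Open Scope ring_scope.

(* The integrand is singular at t = 1; the library sets 0 `^ a = 0 for a != 0,
   which only affects the null set {1}.  Meaningful for 0 <= x <= 1. *)
Definition arcsinp {R : realType} (p x : R) : R :=
  \int[lebesgue_measure]_(t in `[0, x]) ((1 - t `^ p) `^ (- p^-1)).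

Definition pip {R : realType} (p : R) : R := 2 * arcsinp p 1.

(* Inverse of arcsinp p on [0, 1], extended by 0 outside arcsinp p @` [0, 1]. *)
Definition sinp {R : realType} (p : R) : R -> R :=
  'pinv_(fun=> 0) `[0, 1] (arcsinp p).

(* Because of the extension of sinp, this two-sided derivative agrees with the
   p-cosine on the open interval ]0, pip p / 2[ only, not at its endpoints. *)
Definition cosp {R : realType} (p : R) : R -> R := derive1 (sinp p).

Definition arcsinhp {R : realType} (p x : R) : R :=
  \int[lebesgue_measure]_(t in `[0, x]) ((1 + t `^ p) `^ (- p^-1)).

(* Inverse of arcsinhp p on ]0, +oo[, extended by 0 outside its image. *)
Definition sinhp {R : realType} (p : R) : R -> R :=
  'pinv_(fun=> 0) `]0, +oo[ (arcsinhp p).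

Definition coshp {R : realType} (p : R) : R -> R := derive1 (sinhp p).

Definition tanhp {R : realType} (p x : R) : R := sinhp p x / coshp p x.

Definition arctanp {R : realType} (p x : R) : R :=
  \int[lebesgue_measure]_(t in `[0, x]) (1 + t `^ p)^-1.

Definition amean {R : realType} (a b : R) : R := (a + b) / 2.

Definition lmean {R : realType} (a b : R) : R :=
  if a == b then a else (a - b) / (ln a - ln b).

(* Main.v *)
Require Import Defs.
From HB Require Import structures.
From mathcomp Require Import all_boot all_order all_algebra.
From mathcomp Require Import all_classical all_reals all_analysis.
From mathcomp Require Import measurable_realfun ring lra.

Set Implicit Arguments.
Unset Strict Implicit.
Unset Printing Implicit Defensive.

Import Order.TTheory GRing.Theory Num.Theory.
Import numFieldNormedType.Exports.
Local Open Scope ring_scope.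

(* Everything follows from sqrt(ab) <= L(a,b) <= A(a,b).  The functions sin_p,
   log cos_p, tanh_p, arcsinh_p and arctan_p are concave, their derivatives
   cos_p, - tan_p^(p-1), cosh_p^(-p), (1 + x^p)^(-1/p) and (1 + x^p)^(-1) being
   nonincreasing.  Concavity and L <= A give the three upper bounds, since these
   functions are evaluated at A(x,y).  Concavity of log sin_p and log cos_p
   bounds f(x) f(y) by f(A(x,y))^2, so sqrt(ab) <= L gives the two lower bounds;
   for the cosine, L(x,y) <= A(x,y) and 1/cos_p is increasing. *)

(** * Midpoint concavity from a nonincreasing derivative *)

Lemma ameanxx (R : realType) (a : R) : amean a a = a.
Proof. by rewrite /amean; field. Qed.

(** The points [x] and [y] are interior, so differentiability on []a, b[] already yields continuity
    on [[x, y]]. This form suits functions such as [sinp], whose derivative is controlled only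
    inside an interval. *)
Lemma MVT_itvoo (R : realType) (f df : R -> R) (a b x y : R) :
  (forall z, z \in `]a, b[ -> is_derive z 1 f (df z)) ->
  x \in `]a, b[ -> y \in `]a, b[ -> x < y ->
  exists2 c, c \in `]x, y[ & f y - f x = df c * (y - x).
Proof.
move=> fdf; rewrite !in_itv/= => /andP[ax xb] /andP[ay yb] xy.
have dfxy z : x <= z <= y -> is_derive z 1 f (df z).
  move=> /andP[xz zy]; apply: fdf.
  by rewrite in_itv/= (lt_le_trans ax)//= (le_lt_trans zy).
have D z : z \in `]x, y[ -> is_derive z 1 f (df z).
  by rewrite in_itv/= => /andP[xz zy]; apply: dfxy; rewrite !ltW.
have D1 z : z \in `[x, y] -> derivable f z 1.
  by rewrite in_itv/= => zxy; have [] := dfxy _ zxy.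
by have := MVT xy D (derivable_within_continuous D1).
Qed.

(** The midpoint cuts [[x, y]] into two halves of equal length. The mean value theorem gives a slope
    at some [c] in the left half and at some [d] in the right half; as [c < d], the increment over
    the right half is at most that over the left half. *)
Lemma amean_le_of_nincr_derive (R : realType) (f df : R -> R) (a b x y : R) :
  (forall z, z \in `]a, b[ -> is_derive z 1 f (df z)) ->
  {in `]a, b[ &, {homo df : u v /~ u <= v}} ->
  x \in `]a, b[ -> y \in `]a, b[ -> amean (f x) (f y) <= f (amean x y).
Proof.
move=> fdf dfle; wlog xy : x y / x <= y => [th xab yab|xab yab].
  have [/th|/ltW /th] := leP x y; first exact.
  by rewrite /amean addrC (addrC y); exact.
move: xy; rewrite le_eqVlt => /predU1P[->|xy].
  by rewrite !ameanxx.
have xm : x < amean x y by rewrite /amean; lra.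
have my : amean x y < y by rewrite /amean; lra.
move: (xab) (yab); rewrite !in_itv/= => /andP[ax xb] /andP[ay yb].
have mab : amean x y \in `]a, b[.
  by rewrite in_itv/= (lt_trans ax xm) (lt_trans my yb).
have [c + fmx] := MVT_itvoo fdf xab mab xm.
have [d + fym] := MVT_itvoo fdf mab yab my.
rewrite !in_itv/= => /andP[md dy] /andP[xc cm].
have : df d <= df c.
  apply: dfle; rewrite ?in_itv/=.
  - by rewrite (lt_trans ax (lt_trans xm md)) (lt_trans dy yb).
  - by rewrite (lt_trans ax xc) (lt_trans cm (lt_trans my yb)).
  - exact: ltW (lt_trans cm md).
have e1 : y - amean x y = (y - x) / 2 by rewrite /amean; field.
have e2 : amean x y - x = (y - x) / 2 by rewrite /amean; field.
rewrite e1 in fym; rewrite e2 in fmx => dfcd.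
have : df d * ((y - x) / 2) <= df c * ((y - x) / 2).
  by rewrite ler_wpM2r// divr_ge0// subr_ge0 ltW.
by rewrite -fym -fmx {2 3}/amean; lra.
Qed.

(** * The logarithmic mean between the geometric and the arithmetic mean *)

Lemma lmeanC (R : realType) (a b : R) : lmean a b = lmean b a.
Proof.
rewrite /lmean eq_sym; case: eqP => // _.
by rewrite -(opprB b) -(opprB (ln b)) invrN mulrNN.
Qed.

Lemma lmean_ltE (R : realType) (a b : R) : a < b ->
  lmean a b = (b - a) / (ln b - ln a).
Proof. by move=> ab; rewrite lmeanC /lmean gt_eqF. Qed.

(** This is L <= A for the pair 1, r. The left side equals 2 - 4/(r+1), and ln x + 4/(x+1) takes the
    value 2 at 1 and has derivative (x-1)^2 / (x (x+1)^2) >= 0. *)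
Lemma ln_ge_pade (R : realType) (r : R) : 1 < r ->
  2 * (r - 1) / (r + 1) <= ln r.
Proof.
move=> r1.
pose g (x : R) : R := ln x + 4 * (x + 1)^-1.
(* The bound [r + 1] only serves to make both 1 and [r] interior points. *)
have [z z0|||//|c] := @MVT_itvoo R g
  (fun x => x^-1 + 4 * (- (x + 1) ^- 2)) 0 (r + 1) 1 r.
- rewrite in_itv/= in z0; case/andP: z0 => z0 _.
  have z1 : z + 1 != 0 by rewrite gt_eqF// addr_gt0.
  have d1 := is_deriveD (is_derive_id z (1 : R)) (is_derive_cst (1 : R) z 1).
  have dV := is_deriveV (f := fun x : R => x + 1) z1 d1.
  have dg := is_deriveD (is_derive1_ln z0) (is_deriveZ 4 dV).
  by apply: is_derive_eq dg _; rewrite /GRing.scale/= addr0 mulr1.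
- by rewrite in_itv/=; lra.
- by rewrite in_itv/=; lra.
rewrite in_itv/= => /andP[c1 cr].
rewrite /g ln1.
have c0 : 0 < c by lra.
have -> : c^-1 + 4 * - (c + 1) ^- 2 = (c - 1) ^+ 2 / (c * (c + 1) ^+ 2).
  by field; apply/andP; split; apply/eqP; lra.
have : 0 <= (c - 1) ^+ 2 / (c * (c + 1) ^+ 2) * (r - 1).
  by rewrite mulr_ge0 ?divr_ge0 ?mulr_ge0 ?sqr_ge0//; lra.
have -> : 2 * (r - 1) / (r + 1) = 2 - 4 * (r + 1)^-1 by field; apply/eqP; lra.
have -> : 4 * (1 + 1)^-1 = 2 :> R by field.
by move=> + h; rewrite -h; lra.
Qed.

(** This is sqrt(ab) <= L for the pair 1, w^2. The difference of the two sides vanishes at 1 and has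
    derivative (1 - 1/x)^2 / 2 >= 0. *)
Lemma ln_le_symm (R : realType) (w : R) : 1 < w ->
  ln w <= (w - w^-1) / 2.
Proof.
move=> w1.
pose g (x : R) : R := 2^-1 * (x - x^-1) - ln x.
have [z z0|||//|c] := @MVT_itvoo R g
  (fun x => 2^-1 * (1 + x ^- 2) - x^-1) 0 (w + 1) 1 w.
- rewrite in_itv/= in z0; case/andP: z0 => z0 _.
  have dV := is_deriveV (f := id) (lt0r_neq0 z0) (is_derive_id z (1 : R)).
  have dB := is_deriveZ 2^-1 (is_deriveB (is_derive_id z (1 : R)) dV).
  apply: is_derive_eq (is_deriveB dB (is_derive1_ln z0)) _.
  by rewrite /GRing.scale/= mulr1 opprK.
- by rewrite in_itv/=; lra.
- by rewrite in_itv/=; lra.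
rewrite in_itv/= => /andP[c1 cr].
rewrite /g ln1 invr1 !subrr mulr0 !subr0.
have c0 : 0 < c by lra.
have -> : 2^-1 * (1 + c ^- 2) - c^-1 = (1 - c^-1) ^+ 2 / 2.
  by field; apply/eqP; lra.
have : 0 <= (1 - c^-1) ^+ 2 / 2 * (w - 1).
  by rewrite mulr_ge0 ?divr_ge0 ?sqr_ge0//; lra.
move=> + h; rewrite -h; lra.
Qed.

(** Both means are symmetric and homogeneous, so the claim for a < b depends on r = b/a alone; there
    the bound of [ln_ge_pade] reads (b-a) / A(a,b) <= ln(b/a). *)
Lemma lmean_le_amean (R : realType) (a b : R) : 0 < a -> 0 < b ->
  lmean a b <= amean a b.
Proof.
wlog ab : a b / a <= b => [th a0 b0|a0 b0].
  have [/th|/ltW /th] := leP a b; first exact.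
  by rewrite lmeanC /amean addrC; exact.
move: ab; rewrite le_eqVlt => /predU1P[->|ab].
  by rewrite /lmean eqxx ameanxx.
rewrite lmean_ltE// -ln_div ?posrE//.
have r1 : 1 < b / a by rewrite ltr_pdivlMr ?mul1r.
rewrite ler_pdivrMr ?ln_gt0//.
have := ln_ge_pade r1.
have -> : 2 * (b / a - 1) / (b / a + 1) = (b - a) / amean a b.
  by rewrite /amean; field; rewrite !gt_eqF// ?addr_gt0// ?divr_gt0.
have m0 : 0 < amean a b by rewrite divr_gt0 ?addr_gt0.
by rewrite ler_pdivrMr// mulrC.
Qed.

Lemma sqrt_le_lmean (R : realType) (a b : R) : 0 < a -> 0 < b ->
  Num.sqrt (a * b) <= lmean a b.
Proof.
wlog ab : a b / a <= b => [th a0 b0|a0 b0].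
  have [/th|/ltW /th] := leP a b; first exact.
  by rewrite lmeanC mulrC; exact.
move: ab; rewrite le_eqVlt => /predU1P[->|ab].
  by rewrite /lmean eqxx -expr2 sqrtr_sqr gtr0_norm.
rewrite lmean_ltE// -ln_div ?posrE//.
have r1 : 1 < b / a by rewrite ltr_pdivlMr ?mul1r.
rewrite ler_pdivlMr ?ln_gt0//.
(* With b = a w^2 the geometric mean becomes a w and ln(b/a) becomes 2 ln w, so the claim is a w
   times [ln_le_symm]. *)
set w := Num.sqrt (b / a).
have w1 : 1 < w by rewrite -sqrtr1 ltr_sqrt// (lt_trans _ r1).
have w0 : 0 < w by rewrite (lt_trans _ w1).
have wE : w ^+ 2 = b / a by rewrite sqr_sqrtr// divr_ge0 ?ltW.
have bE : b = a * w ^+ 2 by rewrite wE mulrC divfK ?gt_eqF.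
rewrite -wE lnXn// bE mulrA -expr2 -exprMn sqrtr_sqr gtr0_norm ?mulr_gt0//.
have := ln_le_symm w1.
rewrite -(ler_pM2l (mulr_gt0 a0 w0)) => h.
have -> : a * w ^+ 2 - a = 2 * (a * w * ((w - w^-1) / 2)).
  by field; rewrite gt_eqF.
by rewrite mulrnAr -mulr_natl ler_pM2l.
Qed.

(** Reduces each lower bound to f(x) f(y) <= f(m)^2: the geometric mean of 1/a and 1/b is then at
    least 1/m, and L dominates it. *)
Lemma lmean_inv_ge (R : realType) (a b m : R) : 0 < a -> 0 < b -> 0 < m ->
  a * b <= m ^+ 2 -> 1 / m <= lmean (1 / a) (1 / b).
Proof.
move=> a0 b0 m0 abm; rewrite !div1r.
apply: (le_trans _ (@sqrt_le_lmean _ _ _ _ _)); rewrite ?invr_gt0//.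
have ab0 := mulr_gt0 a0 b0.
have : (m^-1) ^+ 2 <= (a * b)^-1.
  by rewrite exprVn lef_pV2// posrE exprn_gt0.
have iab0 : 0 <= (a * b)^-1 by rewrite invr_ge0 ltW.
by rewrite -invfM -ler_sqrt// sqrtr_sqr gtr0_norm ?invr_gt0.
Qed.

Lemma lmean_gt0 (R : realType) (a b : R) : 0 < a -> 0 < b -> 0 < lmean a b.
Proof.
move=> a0 b0; apply: lt_le_trans (@sqrt_le_lmean _ _ _ a0 b0).
by rewrite sqrtr_gt0 mulr_gt0.
Qed.

Lemma mulr_le_sqr_amean (R : realType) (a b : R) : a * b <= amean a b ^+ 2.
Proof.
rewrite -subr_ge0; have -> : amean a b ^+ 2 - a * b = ((a - b) / 2) ^+ 2.
  by rewrite /amean; field.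
exact: sqr_ge0.
Qed.

(** * Derivatives of integrals and inverses, and integrability *)

Lemma is_derive_continuous (R : realType) (f : R -> R) (x df : R) :
  is_derive x 1 f df -> {for x, continuous f}.
Proof.
by move=> [dfx _]; apply: differentiable_continuous; exact/derivable1_diffP.
Qed.

Lemma is_derive_powR_comp (R : realType) (g : R -> R) (x dg a : R) :
  is_derive x 1 g dg -> 0 < g x ->
  is_derive x 1 (fun t => g t `^ a) (a * g x `^ (a - 1) * dg).
Proof.
by move=> dgx gx; have := is_derive1_comp (is_derive1_powR a gx) dgx.
Qed.

Lemma is_derive_Rintegral (R : realType) (f : R -> R) (b x : R) :
  lebesgue_measure.-integrable `[0, b]%classic (EFin \o f) ->
  x \in `]0, b[ -> {for x, continuous f} ->
  is_derive x 1 (fun y => \int[lebesgue_measure]_(t in `[0, y]) f t) (f x).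
Proof.
rewrite in_itv/= => intf /andP[x0 xb] cf.
have [dF F'] := continuous_FTC1_closed xb intf x0 cf.
by constructor; [exact: dF|rewrite -derive1E; exact: F'].
Qed.

Lemma derive_gt0_homo_lt (R : realType) (F f : R -> R) (a b : R) :
  {within `[a, b], continuous F}%classic ->
  (forall z, z \in `]a, b[ -> is_derive z 1 F (f z)) ->
  {in `]a, b[, forall z, 0 < f z} ->
  {in `[a, b] &, {homo F : x y / x < y}}.
Proof.
move=> cF dF f0; apply: (@gtr0_derive1_lt_cc R F a b) => // z zab.
  by have [] := dF _ zab.
by rewrite derive1E; have [_ ->] := dF _ zab; exact: f0.
Qed.

Lemma continuous_itvoo_surj (R : realType) (F : R -> R) (a b y : R) :
  a <= b -> {within `[a, b], continuous F}%classic -> F a < y < F b ->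
  exists2 u, u \in `]a, b[ & F u = y.
Proof.
move=> ab cF /andP[Fay yFb].
have Fab : F a <= F b by rewrite ltW// (lt_trans Fay).
have [|u] := @IVT R F a b y ab cF.
  by rewrite min_l// max_r// !ltW.
rewrite in_itv/= => /andP[au ub] uy; exists u => //.
rewrite in_itv/= !lt_neqAle au ub !andbT; apply/andP; split.
- by apply: contraTneq Fay => ->; rewrite uy ltxx.
- by apply: contraTneq yFb => <-; rewrite uy ltxx.
Qed.

Lemma is_derive_left_inverse (R : realType) (F g f : R -> R) (a b u : R) :
  (forall z, z \in `]a, b[ -> is_derive z 1 F (f z)) ->
  {in `]a, b[, cancel F g} -> u \in `]a, b[ -> f u != 0 ->
  is_derive (F u) 1 g (f u)^-1.
Proof.
move=> dF gK uab fu0; apply: (is_derive_inverse _ _ (dF _ uab) fu0).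
- by near=> z; apply: gK; near: z; exact: near_in_itvoo.
- near=> z; have /dF : z \in `]a, b[ by near: z; exact: near_in_itvoo.
  exact: is_derive_continuous.
Unshelve. all: by end_near. Qed.

(** The real-valued integral is [fine] of the extended one and sends infinite values to 0. A nonzero
    value therefore certifies a finite integral, and a nonnegative function is its own absolute
    value. *)
Lemma integrable_of_Rintegral_neq0 (R : realType) (f : R -> R) (A : set R) :
  measurable A -> measurable_fun A f -> (forall t, 0 <= f t) ->
  \int[lebesgue_measure]_(t in A) f t != 0 ->
  lebesgue_measure.-integrable A (EFin \o f).
Proof.
move=> mA mf f0; rewrite /Rintegral => if0.
apply/integrableP; split; first exact/measurable_EFinP.
under eq_integral do rewrite /= ger0_norm//.
by move: if0; case: (integral _ _ _) => [r| |] //=; rewrite ?ltry ?eqxx ?ltNyr.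
Qed.

Lemma integrable_itv_bounded (R : realType) (f : R -> R) (a b : R) :
  measurable_fun setT f -> (forall t, 0 <= f t <= 1) ->
  lebesgue_measure.-integrable `[a, b]%classic (EFin \o f).
Proof.
move=> mf f01.
have muab : (lebesgue_measure `[a, b]%classic < +oo :> \bar R)%E.
  exact: compact_finite_measure (@segment_compact _ a b).
have mfab : measurable_fun `[a, b]%classic f.
  exact: measurable_funS mf.
have bf : [bounded f t | t in `[a, b]%classic].
  exists 1; split => // M M1 t _ /=; have /andP[f0 f1] := f01 t.
  by rewrite ger0_norm// (le_trans f1)// ltW.
by have := measurable_bounded_integrable (mu := lebesgue_measure)
  (measurable_itv `[a, b]) muab mfab bf.
Qed.

(** * Real powers: measurability, monotonicity, derivatives *)

Lemma measurable_powR_comp (R : realType) (g : R -> R) (a : R) :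
  measurable_fun setT g -> measurable_fun setT (fun t => g t `^ a).
Proof. by move=> mg; exact: measurableT_comp (measurable_powR a) mg. Qed.

Lemma powR_ler_neg (R : realType) (a x y : R) : a <= 0 -> 0 < x -> x <= y ->
  y `^ a <= x `^ a.
Proof.
move=> a0 x0 xy; have y0 := lt_le_trans x0 xy.
rewrite -[a]opprK !(powRN _ (- a)) lef_pV2 ?posrE ?powR_gt0//.
by rewrite ge0_ler_powR ?oppr_ge0// nnegrE ltW.
Qed.

Lemma powR_lt1 (R : realType) (p x : R) : 0 < p -> 0 <= x < 1 -> x `^ p < 1.
Proof.
move=> p0 /andP[x0 x1]; have := @gt0_ltr_powR R p p0 x 1.
by rewrite powR1 !nnegrE; exact.
Qed.

Lemma is_derive_oneBpowR_comp (R : realType) (g : R -> R) (p x dg : R) :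
  is_derive x 1 g dg -> 0 < g x ->
  is_derive x 1 (fun t => 1 - g t `^ p) (- (p * g x `^ (p - 1) * dg)).
Proof.
move=> dgx gx0.
have h := is_deriveB (is_derive_cst (1 : R) x 1) (is_derive_powR_comp p dgx gx0).
by apply: is_derive_eq h _; rewrite sub0r.
Qed.

Lemma is_derive_oneDpowR_comp (R : realType) (g : R -> R) (p x dg : R) :
  is_derive x 1 g dg -> 0 < g x ->
  is_derive x 1 (fun t => 1 + g t `^ p) (p * g x `^ (p - 1) * dg).
Proof.
move=> dgx gx0.
have h := is_deriveD (is_derive_cst (1 : R) x 1) (is_derive_powR_comp p dgx gx0).
by apply: is_derive_eq h _; rewrite add0r.
Qed.

(** * The functions arcsin_p and sin_p *)

(* If the integral diverged, [fine] would turn it into [0] and [pip p] would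
   vanish. *)
Lemma integrable_arcsinp (R : realType) (p : R) : 0 < pip p ->
  lebesgue_measure.-integrable `[0, 1]%classic
    (EFin \o (fun t : R => (1 - t `^ p) `^ (- p^-1))).
Proof.
rewrite /pip pmulr_rgt0// => a0.
have ma : measurable_fun setT (fun t : R => (1 - t `^ p) `^ (- p^-1)).
  apply: measurable_powR_comp.
  exact: measurable_funB (measurable_cst (1 : R)) (measurable_powR p).
have := @integrable_of_Rintegral_neq0 R (fun t : R => (1 - t `^ p) `^ (- p^-1))
  `[0, 1]%classic (measurable_itv `[0, 1]).
apply.
- exact: measurable_funS ma.
- by move=> t; exact: powR_ge0.
- by rewrite gt_eqF.
Qed.

Lemma is_derive_arcsinp (R : realType) (p u : R) : 1 < p -> 0 < pip p ->
  u \in `]0, 1[ -> is_derive u 1 (arcsinp p) ((1 - u `^ p) `^ (- p^-1)).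
Proof.
move=> p1 pip0 u01; have := u01; rewrite in_itv/= => /andP[u0 u1].
have up1 : 0 < 1 - u `^ p.
  by rewrite subr_gt0 powR_lt1 ?(lt_trans _ p1)// ltW.
(* The fundamental theorem of calculus asks for continuity of the integrand at [u]; it comes from
   differentiability there, as 1 - u^p > 0. *)
have d1 := is_derive_oneBpowR_comp p (is_derive_id u (1 : R)) u0.
have cu := is_derive_continuous (is_derive_powR_comp (- p^-1) d1 up1).
exact: is_derive_Rintegral (integrable_arcsinp pip0) u01 cu.
Qed.

(** Integrability alone gives continuity up to the endpoint 1, where the integral is improper. *)
Lemma arcsinp_continuous (R : realType) (p : R) : 0 < pip p ->
  {within `[0, 1], continuous (arcsinp p)}%classic.
Proof.
move=> pip0.
by have := parameterized_integral_continuous ler01 (integrable_arcsinp pip0).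
Qed.

Lemma arcsinp0 (R : realType) (p : R) : arcsinp p 0 = 0.
Proof. by rewrite /arcsinp set_itv1 Rintegral_set1. Qed.

Lemma arcsinp_lt (R : realType) (p : R) : 1 < p -> 0 < pip p ->
  {in `[0, 1] &, {homo arcsinp p : x y / x < y}}.
Proof.
move=> p1 pip0.
apply: (derive_gt0_homo_lt (arcsinp_continuous pip0)) => z z01.
  exact: is_derive_arcsinp.
move: z01; rewrite in_itv/= => /andP[z0 z1].
by rewrite powR_gt0// subr_gt0 powR_lt1 ?(lt_trans _ p1)// ltW.
Qed.

(** The partial inverse [sinp] undoes [arcsinp] on [[0, 1]] once injectivity there is known, and
    strict monotonicity provides it. *)
Lemma arcsinpK (R : realType) (p : R) : 1 < p -> 0 < pip p ->
  {in `[0, 1], cancel (arcsinp p) (sinp p)}.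
Proof.
move=> p1 pip0 u u01; apply: pinvKV; last exact/mem_set.
move=> x y /set_mem/= x01 /set_mem/= y01 xy.
have lt := arcsinp_lt p1 pip0.
have [/(lt _ _ x01 y01)|/(lt _ _ y01 x01)|//] := ltgtP x y.
  by rewrite xy ltxx.
by rewrite xy ltxx.
Qed.

(** The value of pi_p is never computed: any point of []0, pip p / 2[] witnesses that it is
    positive, and from this the convergence of the singular integral follows. *)
Lemma pip_gt0 (R : realType) (p x : R) : 0 < x < pip p / 2 -> 0 < pip p.
Proof. by move=> /andP[x0 xp]; lra. Qed.

Lemma arcsinp_surj (R : realType) (p x : R) : 0 < x < pip p / 2 ->
  exists2 u, u \in `]0, 1[ & arcsinp p u = x.
Proof.
move=> xp; apply: continuous_itvoo_surj => //.
  exact/arcsinp_continuous/(pip_gt0 xp).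
by rewrite arcsinp0; move: xp; rewrite /pip [2 * _]mulrC mulfK ?pnatr_eq0.
Qed.

Lemma sinp_itv (R : realType) (p x : R) : 1 < p -> 0 < x < pip p / 2 ->
  0 < sinp p x < 1.
Proof.
move=> p1 xp; have [u u01 <-] := arcsinp_surj xp.
by rewrite (arcsinpK p1 (pip_gt0 xp)) ?(subset_itv_oo_cc u01).
Qed.

Lemma sinpK (R : realType) (p x : R) : 1 < p -> 0 < x < pip p / 2 ->
  arcsinp p (sinp p x) = x.
Proof.
move=> p1 xp; have [u u01 <-] := arcsinp_surj xp.
by rewrite (arcsinpK p1 (pip_gt0 xp)) ?(subset_itv_oo_cc u01).
Qed.

Lemma sinp_le (R : realType) (p x y : R) : 1 < p ->
  0 < x < pip p / 2 -> 0 < y < pip p / 2 -> x <= y -> sinp p x <= sinp p y.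
Proof.
move=> p1 xp yp; apply: contra_le => yx.
have [/andP[sx0 sx1] /andP[sy0 sy1]] := (sinp_itv p1 xp, sinp_itv p1 yp).
rewrite -(sinpK p1 xp) -(sinpK p1 yp).
by apply: (arcsinp_lt p1 (pip_gt0 xp));
  rewrite ?in_itv/= ?(ltW sx0) ?(ltW sy0) ?(ltW sx1) ?(ltW sy1).
Qed.

Lemma oneBsinp_powR_gt0 (R : realType) (p x : R) : 1 < p ->
  0 < x < pip p / 2 -> 0 < 1 - sinp p x `^ p.
Proof.
move=> p1 xp; have /andP[s0 s1] := sinp_itv p1 xp.
by rewrite subr_gt0 powR_lt1 ?(lt_trans _ p1)// ltW.
Qed.

Lemma is_derive_sinp (R : realType) (p x : R) : 1 < p -> 0 < x < pip p / 2 ->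
  is_derive x 1 (sinp p) ((1 - sinp p x `^ p) `^ p^-1).
Proof.
move=> p1 xp; have pip0 := pip_gt0 xp.
have := oneBsinp_powR_gt0 p1 xp.
have [u u01 ux] := arcsinp_surj xp.
rewrite -ux (arcsinpK p1 pip0) ?(subset_itv_oo_cc u01)// => up0.
have du (z : R) : z \in `]0, 1[ ->
    is_derive z 1 (arcsinp p) ((1 - z `^ p) `^ (- p^-1)).
  exact: is_derive_arcsinp.
have gK : {in `]0, 1[%R, cancel (arcsinp p) (sinp p)}.
  by move=> z z01; rewrite (arcsinpK p1 pip0) ?(subset_itv_oo_cc z01).
have := is_derive_left_inverse du gK u01.
by rewrite powRN invrK; apply; rewrite gt_eqF// invr_gt0 powR_gt0.
Qed.

(** * The function cos_p and the two lower bounds *)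

Lemma cospE (R : realType) (p x : R) : 1 < p -> 0 < x < pip p / 2 ->
  cosp p x = (1 - sinp p x `^ p) `^ p^-1.
Proof.
by move=> p1 xp; rewrite /cosp derive1E; have [_ ->] := is_derive_sinp p1 xp.
Qed.

Lemma oneBpowR_ge (R : realType) (p s t : R) :
  0 < p -> 0 <= s -> s <= t -> 1 - t `^ p <= 1 - s `^ p.
Proof.
move=> p0 s0 st.
by rewrite lerD2l lerN2 ge0_ler_powR ?nnegrE ?(ltW p0) ?s0 ?(le_trans s0 st).
Qed.

(** For s = sin_p(z) the product is tan_p(z)^(p-1), since (1 - s^p)^(1/p - 1) = cos_p(z)^(1-p). Both
    factors are nonnegative and nondecreasing in s. *)
Lemma powR_mul_oneBpowR_le (R : realType) (p s t : R) :
  1 < p -> 0 <= s -> s <= t -> 0 < 1 - t `^ p ->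
  s `^ (p - 1) * (1 - s `^ p) `^ (p^-1 - 1) <=
  t `^ (p - 1) * (1 - t `^ p) `^ (p^-1 - 1).
Proof.
move=> p1 s0 st t1; have p0 : 0 < p := lt_trans ltr01 p1.
have st1 : s `^ (p - 1) <= t `^ (p - 1).
  by rewrite ge0_ler_powR ?nnegrE ?s0 ?(le_trans s0 st)// subr_ge0 ltW.
have q0 : p^-1 - 1 <= 0 by rewrite subr_le0 invf_le1// ltW.
exact: ler_pM (powR_ge0 _ _) (powR_ge0 _ _) st1
  (powR_ler_neg q0 t1 (oneBpowR_ge p0 s0 st)).
Qed.

(** Turns midpoint concavity of a logarithm into a product bound. It is used with [q] = 1/p and
    bases 1 - sin_p^p, whose powers are values of cos_p. *)
Lemma mulr_powR_le_sqr (R : realType) (q u v w : R) :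
  0 <= q -> 0 < u -> 0 < v -> 0 < w -> amean (ln u) (ln v) <= ln w ->
  u `^ q * v `^ q <= (w `^ q) ^+ 2.
Proof.
move=> q0 u0 v0 w0 uvw.
have uvw2 : u * v <= w * w.
  rewrite -ler_ln ?posrE ?mulr_gt0// !lnM ?posrE//.
  by move: uvw; rewrite /amean ler_pdivrMr// mulr_natr mulr2n.
rewrite expr2 -powRM ?(ltW u0) ?(ltW v0)// -powRM ?(ltW w0)//.
by rewrite (ge0_ler_powR q0 _ _ uvw2)// nnegrE ltW ?mulr_gt0.
Qed.

Lemma cosp_gt0 (R : realType) (p x : R) : 1 < p -> 0 < x < pip p / 2 ->
  0 < cosp p x.
Proof.
by move=> p1 xp; rewrite cospE//; exact/powR_gt0/oneBsinp_powR_gt0.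
Qed.

Lemma cosp_le (R : realType) (p x y : R) : 1 < p ->
  0 < x < pip p / 2 -> 0 < y < pip p / 2 -> x <= y -> cosp p y <= cosp p x.
Proof.
move=> p1 xp yp xy; have p0 : 0 < p := lt_trans ltr01 p1.
have cy := oneBsinp_powR_gt0 p1 yp.
have /andP[/ltW sx0 _] := sinp_itv p1 xp.
have cxy := oneBpowR_ge p0 sx0 (sinp_le p1 xp yp xy).
have ip0 : 0 <= p^-1 by rewrite invr_ge0 ltW.
rewrite (cospE p1 xp) (cospE p1 yp) (ge0_ler_powR ip0 _ _ cxy) // nnegrE.
  exact: ltW.
exact: le_trans (ltW cy) cxy.
Qed.

Lemma amean_itvoo (R : realType) (a b x y : R) :
  a < x < b -> a < y < b -> a < amean x y < b.
Proof. by rewrite /amean => /andP[? ?] /andP[? ?]; lra. Qed.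

Lemma lmean_sinp (R : realType) (p x y : R) : 1 < p ->
  0 < x < pip p / 2 -> 0 < y < pip p / 2 ->
  lmean (1 / sinp p x) (1 / sinp p y) >= 1 / sinp p (amean x y).
Proof.
move=> p1 xp yp; have mp := amean_itvoo xp yp.
have [/andP[sx0 _] /andP[sy0 _]] := (sinp_itv p1 xp, sinp_itv p1 yp).
have /andP[sm0 _] := sinp_itv p1 mp.
apply: lmean_inv_ge => //.
(* By AM-GM the product is at most the square of the mean of the two sines, so concavity of sin_p
   itself suffices. *)
apply: (le_trans (mulr_le_sqr_amean _ _)).
rewrite ler_pXn2r ?nnegrE ?(ltW sm0) ?(ltW (divr_gt0 (addr_gt0 sx0 sy0) _))//.
have ds (z : R) : z \in `]0, (pip p / 2)[ -> is_derive z 1 (sinp p) (cosp p z).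
  by rewrite in_itv/= => zp; rewrite cospE//; exact: is_derive_sinp.
suff h : {in `]0, (pip p / 2)[ &, {homo cosp p : u v /~ u <= v}}.
  by have := amean_le_of_nincr_derive ds h xp yp.
by move=> u v; rewrite !in_itv/= => up vp vu; exact: cosp_le.
Qed.

(** The function is p log cos_p, with derivative -p tan_p^(p-1). Writing it through [sinp] avoids
    differentiating [cosp], which is itself defined as a derivative. *)
Lemma ln_oneBsinp_powR_concave (R : realType) (p x y : R) : 1 < p ->
  0 < x < pip p / 2 -> 0 < y < pip p / 2 ->
  amean (ln (1 - sinp p x `^ p)) (ln (1 - sinp p y `^ p)) <=
  ln (1 - sinp p (amean x y) `^ p).
Proof.
move=> p1 xp yp; have p0 : 0 < p := lt_trans ltr01 p1.
pose dl z := - (p * (sinp p z `^ (p - 1) * (1 - sinp p z `^ p) `^ (p^-1 - 1))).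
have ds (z : R) : z \in `]0, (pip p / 2)[ ->
    is_derive z 1 (fun z => ln (1 - sinp p z `^ p)) (dl z).
  rewrite in_itv/= => zp; have /andP[sz0 _] := sinp_itv p1 zp.
  have c0 := oneBsinp_powR_gt0 p1 zp.
  have d1 := is_derive_oneBpowR_comp p (is_derive_sinp p1 zp) sz0.
  have d2 := is_derive1_comp (g := fun z => 1 - sinp p z `^ p)
    (is_derive1_ln c0) d1.
  (* Lowering the exponent by one becomes a division, so that [field] can compare the two forms of
     the derivative. *)
  have cE : (1 - sinp p z `^ p) `^ (p^-1 - 1) =
      (1 - sinp p z `^ p) `^ p^-1 / (1 - sinp p z `^ p).
    by rewrite powRB ?powRr1 ?(ltW c0)// (gt_eqF c0) implybT.
  by apply: is_derive_eq d2 _; rewrite /dl cE; field; rewrite gt_eqF.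
suff h : {in `]0, (pip p / 2)[ &, {homo dl : u v /~ u <= v}}.
  by have := amean_le_of_nincr_derive ds h xp yp.
move=> u v; rewrite !in_itv/= => up vp vu.
have /andP[/ltW sv0 _] := sinp_itv p1 vp.
have su1 := oneBsinp_powR_gt0 p1 up.
have := powR_mul_oneBpowR_le p1 sv0 (sinp_le p1 vp up vu) su1.
by rewrite -(ler_pM2l p0) -lerN2.
Qed.

Lemma lmean_cosp (R : realType) (p x y : R) : 1 < p ->
  0 < x < pip p / 2 -> 0 < y < pip p / 2 ->
  lmean (1 / cosp p x) (1 / cosp p y) >= 1 / cosp p (lmean x y).
Proof.
move=> p1 xp yp; have p0 : 0 < p := lt_trans ltr01 p1.
have [/andP[x0 xpi] /andP[y0 ypi]] := (xp, yp).
have mp := amean_itvoo xp yp.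
(* [cospE] and monotonicity hold on []0, pip p / 2[], so L(x,y) is first placed there, between 0 and
   A(x,y). *)
have L0 := lmean_gt0 x0 y0; have LA := lmean_le_amean x0 y0.
have Lp : 0 < lmean x y < pip p / 2.
  by rewrite L0 (le_lt_trans LA)//; case/andP: mp.
apply: (@le_trans _ _ (1 / cosp p (amean x y))).
  by rewrite !div1r lef_pV2 ?posrE ?cosp_gt0// (cosp_le p1 Lp mp LA).
apply: (lmean_inv_ge (cosp_gt0 p1 xp) (cosp_gt0 p1 yp) (cosp_gt0 p1 mp)).
rewrite (cospE p1 xp) (cospE p1 yp) (cospE p1 mp).
have ip0 : 0 <= p^-1 by rewrite invr_ge0 ltW.
exact: mulr_powR_le_sqr ip0 (oneBsinp_powR_gt0 p1 xp)
  (oneBsinp_powR_gt0 p1 yp) (oneBsinp_powR_gt0 p1 mp)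
  (ln_oneBsinp_powR_concave p1 xp yp).
Qed.

(** * The functions arcsinh_p, sinh_p and tanh_p *)

Lemma oneDpowR_gt0 (R : realType) (p t : R) : 0 < 1 + t `^ p.
Proof. by rewrite ltr_pwDl// powR_ge0. Qed.

Lemma oneDpowR_le (R : realType) (p s t : R) :
  0 < p -> 0 <= s -> s <= t -> 1 + s `^ p <= 1 + t `^ p.
Proof.
move=> p0 s0 st.
by rewrite lerD2l ge0_ler_powR ?nnegrE ?(ltW p0) ?s0 ?(le_trans s0 st).
Qed.

Lemma measurable_oneDpowR (R : realType) (p : R) :
  measurable_fun setT (fun t : R => 1 + t `^ p).
Proof.
exact: measurable_funD (measurable_cst (1 : R)) (measurable_powR p).
Qed.

Lemma is_derive_oneDpowR (R : realType) (p u : R) : 0 < u ->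
  is_derive u 1 (fun t : R => 1 + t `^ p) (p * u `^ (p - 1) * 1).
Proof. exact: is_derive_oneDpowR_comp (is_derive_id u (1 : R)). Qed.

Lemma integrable_arcsinhp (R : realType) (p b : R) : 0 < p ->
  lebesgue_measure.-integrable `[0, b]%classic
    (EFin \o (fun t : R => (1 + t `^ p) `^ (- p^-1))).
Proof.
move=> p0; apply: integrable_itv_bounded => [|t].
  exact: measurable_powR_comp (measurable_oneDpowR p).
rewrite powR_ge0/= -[leRHS](powRr0 (1 + t `^ p)) ler_powR//.
  by rewrite lerDl powR_ge0.
by rewrite oppr_le0 invr_ge0 ltW.
Qed.

Lemma is_derive_arcsinhp (R : realType) (p u : R) : 0 < p -> 0 < u ->
  is_derive u 1 (arcsinhp p) ((1 + u `^ p) `^ (- p^-1)).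
Proof.
move=> p0 u0.
have cu := is_derive_continuous
  (is_derive_powR_comp (- p^-1) (is_derive_oneDpowR p u0) (oneDpowR_gt0 p u)).
(* The integral is differentiated on a bounded interval having [u] in its interior; [u + 1] is a
   convenient right end. *)
have u01 : u \in `]0, (u + 1)[ by rewrite in_itv/= u0 ltrDl/=.
exact: is_derive_Rintegral (integrable_arcsinhp (u + 1) p0) u01 cu.
Qed.

Lemma arcsinhp_continuous (R : realType) (p b : R) : 0 < p -> 0 <= b ->
  {within `[0, b], continuous (arcsinhp p)}%classic.
Proof.
move=> p0 b0.
by have := parameterized_integral_continuous b0 (integrable_arcsinhp b p0).
Qed.

Lemma arcsinhp0 (R : realType) (p : R) : arcsinhp p 0 = 0.
Proof. by rewrite /arcsinhp set_itv1 Rintegral_set1. Qed.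

Lemma arcsinhp_lt (R : realType) (p x y : R) : 0 < p -> 0 <= x -> x < y ->
  arcsinhp p x < arcsinhp p y.
Proof.
move=> p0 x0 xy; have y0 : 0 <= y := le_trans x0 (ltW xy).
apply: (derive_gt0_homo_lt (f := fun u => (1 + u `^ p) `^ (- p^-1))
  (arcsinhp_continuous p0 y0)) => //.
- by move=> z; rewrite in_itv/= => /andP[z0 _]; exact: is_derive_arcsinhp.
- by move=> z _; exact/powR_gt0/oneDpowR_gt0.
- by rewrite in_itv/= x0 ltW.
- by rewrite in_itv/= y0 lexx.
Qed.

Lemma arcsinhp_gt0 (R : realType) (p x : R) : 0 < p -> 0 < x -> 0 < arcsinhp p x.
Proof. by move=> p0 x0; rewrite -(arcsinhp0 p) arcsinhp_lt. Qed.

(* For [1 <= t] we have [1 + t^p <= 2 t^p <= (2t)^p]. *)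
Lemma oneDpowRV_ge (R : realType) (p t : R) : 1 < p -> 1 <= t ->
  2^-1 * t^-1 <= (1 + t `^ p) `^ (- p^-1).
Proof.
move=> p1 t1; have p0 : 0 < p := lt_trans ltr01 p1.
have t0 : 0 < t := lt_le_trans ltr01 t1.
have tp1 : 1 <= t `^ p by rewrite (le_trans t1)// le1r_powR// ltW.
have t2p : 1 + t `^ p <= (2 * t) `^ p.
  rewrite powRM// ?(ltW t0)//.
  have h2 : 2 <= 2 `^ p :> R by rewrite le1r_powR ?ltW// ltr1n.
  apply: (@le_trans _ _ (2 * t `^ p)); first by rewrite mulr_natl mulr2n lerD2r.
  by rewrite ler_wpM2r// powR_ge0.
rewrite -invfM.
have -> : (2 * t)^-1 = ((2 * t) `^ p) `^ (- p^-1).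
  by rewrite -powRrM mulrN mulfV ?gt_eqF// powR_inv1// mulr_ge0// ltW.
apply: powR_ler_neg t2p; last exact: oneDpowR_gt0.
by rewrite oppr_le0 invr_ge0 ltW.
Qed.

(** On [[1, b]] the integrand is at least 1/(2t), so arcsinh_p grows there by at least ln(b)/2;
    strictness comes from arcsinh_p(1) > 0. Hence arcsinh_p is unbounded and sinh_p is defined on
    all positive reals. *)
Lemma arcsinhp_gt_ln (R : realType) (p b : R) : 1 < p -> 1 < b ->
  ln b / 2 < arcsinhp p b.
Proof.
move=> p1 b1; have p0 : 0 < p := lt_trans ltr01 p1.
have dg (z : R) : z \in `]0, (b + 1)[ ->
    is_derive z 1 (fun z => arcsinhp p z - 2^-1 * ln z)
      ((1 + z `^ p) `^ (- p^-1) - 2^-1 * z^-1).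
  rewrite in_itv/= => /andP[z0 _].
  exact: is_deriveB (is_derive_arcsinhp p0 z0)
    (is_deriveZ 2^-1 (is_derive1_ln z0)).
have I1 : 1 \in `]0, (b + 1)[ by rewrite in_itv/=; lra.
have Ib : b \in `]0, (b + 1)[ by rewrite in_itv/=; lra.
have [c] := MVT_itvoo dg I1 Ib b1.
rewrite in_itv/= => /andP[c1 _]; rewrite ln1 mulr0 subr0 => h.
have : 0 <= ((1 + c `^ p) `^ (- p^-1) - 2^-1 * c^-1) * (b - 1).
  by rewrite mulr_ge0// subr_ge0 ?oneDpowRV_ge// ltW.
by have := arcsinhp_gt0 p0 (@ltr01 R); rewrite -h; lra.
Qed.

Lemma arcsinhp_surj (R : realType) (p x : R) : 1 < p -> 0 < x ->
  exists2 u, 0 < u & arcsinhp p u = x.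
Proof.
move=> p1 x0; have p0 : 0 < p := lt_trans ltr01 p1.
(* The choice b = exp(2x) turns the logarithmic lower bound into x itself, giving an upper end for
   the intermediate value theorem. *)
have [b b1 lnb] : exists2 b : R, 1 < b & ln b / 2 = x.
  exists (expR (x * 2)); first by rewrite expR_gt1 mulr_gt0.
  by rewrite expRK mulfK ?pnatr_eq0.
have b0 : 0 <= b by rewrite (le_trans ler01)// ltW.
have x0b : arcsinhp p 0 < x < arcsinhp p b.
  by rewrite arcsinhp0 x0 -lnb arcsinhp_gt_ln.
have [u] := continuous_itvoo_surj b0 (arcsinhp_continuous p0 b0) x0b.
by rewrite in_itv/= => /andP[u0 _] ux; exists u.
Qed.

Lemma arcsinhpK (R : realType) (p u : R) : 0 < p -> 0 < u ->
  sinhp p (arcsinhp p u) = u.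
Proof.
move=> p0 u0; apply: pinvKV; last by apply/mem_set; rewrite /= in_itv/= u0.
move=> x y /set_mem/=; rewrite in_itv/= andbT => x0.
move=> /set_mem/=; rewrite in_itv/= andbT => y0 xy.
have [/(arcsinhp_lt p0 (ltW x0))|/(arcsinhp_lt p0 (ltW y0))|//] := ltgtP x y.
  by rewrite xy ltxx.
by rewrite xy ltxx.
Qed.

Lemma sinhp_gt0 (R : realType) (p x : R) : 1 < p -> 0 < x -> 0 < sinhp p x.
Proof.
move=> p1 x0; have [u u0 <-] := arcsinhp_surj p1 x0.
by rewrite arcsinhpK// (lt_trans _ p1).
Qed.

Lemma sinhpK (R : realType) (p x : R) : 1 < p -> 0 < x ->
  arcsinhp p (sinhp p x) = x.
Proof.
move=> p1 x0; have [u u0 <-] := arcsinhp_surj p1 x0.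
by rewrite arcsinhpK// (lt_trans _ p1).
Qed.

Lemma sinhp_le (R : realType) (p x y : R) : 1 < p -> 0 < x -> 0 < y -> x <= y ->
  sinhp p x <= sinhp p y.
Proof.
move=> p1 x0 y0; apply: contra_le => yx.
rewrite -(sinhpK p1 x0) -(sinhpK p1 y0).
exact: arcsinhp_lt (lt_trans ltr01 p1) (ltW (sinhp_gt0 p1 y0)) yx.
Qed.

Lemma is_derive_sinhp (R : realType) (p x : R) : 1 < p -> 0 < x ->
  is_derive x 1 (sinhp p) ((1 + sinhp p x `^ p) `^ p^-1).
Proof.
move=> p1 x0; have p0 : 0 < p := lt_trans ltr01 p1.
have [u u0 <-] := arcsinhp_surj p1 x0; rewrite (arcsinhpK p0 u0).
have du (z : R) : z \in `]0, (u + 1)[ ->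
    is_derive z 1 (arcsinhp p) ((1 + z `^ p) `^ (- p^-1)).
  by rewrite in_itv/= => /andP[z0 _]; exact: is_derive_arcsinhp.
have gK : {in `]0, (u + 1)[%R, cancel (arcsinhp p) (sinhp p)}.
  by move=> z; rewrite in_itv/= => /andP[z0 _]; exact: arcsinhpK.
have u01 : u \in `]0, (u + 1)[ by rewrite in_itv/= u0 ltrDl/=.
have := is_derive_left_inverse du gK u01.
by rewrite powRN invrK; apply; rewrite gt_eqF// invr_gt0 powR_gt0// oneDpowR_gt0.
Qed.

Lemma coshpE (R : realType) (p x : R) : 1 < p -> 0 < x ->
  coshp p x = (1 + sinhp p x `^ p) `^ p^-1.
Proof.
by move=> p1 x0; rewrite /coshp derive1E; have [_ ->] := is_derive_sinhp p1 x0.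
Qed.

Lemma coshp_gt0 (R : realType) (p x : R) : 1 < p -> 0 < x -> 0 < coshp p x.
Proof.
by move=> p1 x0; rewrite (coshpE p1 x0); exact/powR_gt0/oneDpowR_gt0.
Qed.

Lemma tanhp_gt0 (R : realType) (p x : R) : 1 < p -> 0 < x -> 0 < tanhp p x.
Proof.
by move=> p1 x0; exact: divr_gt0 (sinhp_gt0 p1 x0) (coshp_gt0 p1 x0).
Qed.

Lemma tanhpE (R : realType) (p x : R) : 1 < p -> 0 < x ->
  tanhp p x = sinhp p x * (1 + sinhp p x `^ p) `^ (- p^-1).
Proof. by move=> p1 x0; rewrite /tanhp (coshpE p1 x0) powRN. Qed.

(** Since sinh_p' = cosh_p, the quotient rule gives tanh_p' = 1 - sinh_p^p / cosh_p^p = cosh_p^(-p),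
    that is (1 + sinh_p^p)^(-1), which decreases because sinh_p increases. *)
Lemma tanhp_concave (R : realType) (p x y : R) : 1 < p -> 0 < x -> 0 < y ->
  amean (tanhp p x) (tanhp p y) <= tanhp p (amean x y).
Proof.
move=> p1 x0 y0; have p0 : 0 < p := lt_trans ltr01 p1.
have m0 : 0 < amean x y by rewrite divr_gt0 ?addr_gt0.
pose dT z := (1 + sinhp p z `^ p)^-1.
(* The interval []0, x + y[] contains both [x] and [y] by positivity. *)
have dt (z : R) : z \in `]0, (x + y)[ ->
    is_derive z 1 (fun z => sinhp p z * (1 + sinhp p z `^ p) `^ (- p^-1)) (dT z).
  rewrite in_itv/= => /andP[z0 _].
  have s0 := sinhp_gt0 p1 z0; have ds := is_derive_sinhp p1 z0.
  have d1 := is_derive_oneDpowR_comp p ds s0.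
  have dP := is_derive_powR_comp (- p^-1) d1 (oneDpowR_gt0 _ _).
  apply: is_derive_eq (is_deriveM ds dP) _.
  rewrite /dT /GRing.scale/=; move: (sinhp p z) s0 => s s0 {ds d1 dP}.
  have w0 := oneDpowR_gt0 p s.
  (* Once the unit shifts of the exponents are split off, only s, s^p and C = (1 + s^p)^(1/p)
     remain, and the claim is a rational identity in them. *)
  have -> : (1 + s `^ p) `^ (- p^-1 - 1) =
      (1 + s `^ p) `^ (- p^-1) / (1 + s `^ p).
    by rewrite powRB ?powRr1 ?(ltW w0)// (gt_eqF w0) implybT.
  have C0 := powR_gt0 p^-1 w0.
  rewrite powRN.
  have -> : s `^ (p - 1) = s `^ p / s.
    by rewrite powRB ?powRr1 ?(ltW s0)// (gt_eqF s0) implybT.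
  move: ((1 + s `^ p) `^ p^-1) C0 w0 => C C0; move: (s `^ p) => w w0.
  by field; rewrite !gt_eqF.
suff h : {in `]0, (x + y)[ &, {homo dT : u v /~ u <= v}}.
  have Ix : x \in `]0, (x + y)[ by rewrite in_itv/= x0 ltrDl.
  have Iy : y \in `]0, (x + y)[ by rewrite in_itv/= y0 ltrDr.
  have := amean_le_of_nincr_derive dt h Ix Iy.
  by rewrite -(tanhpE p1 x0) -(tanhpE p1 y0) -(tanhpE p1 m0).
move=> u v; rewrite !in_itv/= => /andP[u0 _] /andP[v0 _] vu.
rewrite /dT lef_pV2 ?posrE ?oneDpowR_gt0//.
exact: oneDpowR_le p0 (ltW (sinhp_gt0 p1 v0)) (sinhp_le p1 v0 u0 vu).
Qed.

Lemma arcsinhp_concave (R : realType) (p x y : R) : 0 < p -> 0 < x -> 0 < y ->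
  amean (arcsinhp p x) (arcsinhp p y) <= arcsinhp p (amean x y).
Proof.
move=> p0 x0 y0.
have df (z : R) : z \in `]0, (x + y)[ ->
    is_derive z 1 (arcsinhp p) ((1 + z `^ p) `^ (- p^-1)).
  by rewrite in_itv/= => /andP[z0 _]; exact: is_derive_arcsinhp.
have Ix : x \in `]0, (x + y)[ by rewrite in_itv/= x0 ltrDl.
have Iy : y \in `]0, (x + y)[ by rewrite in_itv/= y0 ltrDr.
suff h : {in `]0, (x + y)[ &,
    {homo (fun z => (1 + z `^ p) `^ (- p^-1)) : u v /~ u <= v}}.
  exact: amean_le_of_nincr_derive df h Ix Iy.
move=> u v; rewrite !in_itv/= => _ /andP[v0 _] vu.
apply: (powR_ler_neg _ (oneDpowR_gt0 p v) (oneDpowR_le p0 (ltW v0) vu)).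
by rewrite oppr_le0 invr_ge0 ltW.
Qed.

(** * The function arctan_p and the five inequalities *)

Lemma integrable_arctanp (R : realType) (p b : R) :
  lebesgue_measure.-integrable `[0, b]%classic
    (EFin \o (fun t : R => (1 + t `^ p)^-1)).
Proof.
(* As a power with exponent -1, the integrand gets its measurability and its bounds 0 and 1 from the
   lemmas on powers. *)
have -> : (fun t : R => (1 + t `^ p)^-1) = (fun t => (1 + t `^ p) `^ (- 1)).
  by apply/funext => t; rewrite powR_inv1// ltW// oneDpowR_gt0.
apply: integrable_itv_bounded => [|t].
  exact: measurable_powR_comp (measurable_oneDpowR p).
by rewrite powR_ge0/= -[leRHS](powRr0 (1 + t `^ p)) ler_powR// lerDl powR_ge0.
Qed.

Lemma is_derive_arctanp (R : realType) (p u : R) : 0 < u ->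
  is_derive u 1 (arctanp p) (1 + u `^ p)^-1.
Proof.
move=> u0; have w0 : 1 + u `^ p != 0 by rewrite gt_eqF// oneDpowR_gt0.
have cu := is_derive_continuous
  (is_deriveV (f := fun t : R => 1 + t `^ p) w0 (is_derive_oneDpowR p u0)).
have u01 : u \in `]0, (u + 1)[ by rewrite in_itv/= u0 ltrDl/=.
exact: is_derive_Rintegral (integrable_arctanp p (u + 1)) u01 cu.
Qed.

(** Supplies the positivity that [lmean_le_amean] asks of its arguments: the integral vanishes at 0
    and has a positive derivative. *)
Lemma arctanp_gt0 (R : realType) (p x : R) : 0 < x -> 0 < arctanp p x.
Proof.
move=> x0.
have cx : {within `[0, x], continuous (arctanp p)}%classic.
  by have := parameterized_integral_continuous (ltW x0) (integrable_arctanp p x).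
have dx (z : R) : z \in `]0, x[ -> is_derive z 1 (arctanp p) (1 + z `^ p)^-1.
  by rewrite in_itv/= => /andP[z0 _]; exact: is_derive_arctanp.
have f0 : {in `]0, x[, forall z, 0 < (1 + z `^ p)^-1}.
  by move=> z _; rewrite invr_gt0 oneDpowR_gt0.
have I0 : 0 \in `[0, x] by rewrite in_itv/= lexx ltW.
have Ix : x \in `[0, x] by rewrite in_itv/= lexx ltW.
have := derive_gt0_homo_lt cx dx f0 I0 Ix x0.
by rewrite {1}/arctanp set_itv1 Rintegral_set1.
Qed.

Lemma arctanp_concave (R : realType) (p x y : R) : 0 < p -> 0 < x -> 0 < y ->
  amean (arctanp p x) (arctanp p y) <= arctanp p (amean x y).
Proof.
move=> p0 x0 y0.
have df (z : R) : z \in `]0, (x + y)[ ->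
    is_derive z 1 (arctanp p) (1 + z `^ p)^-1.
  by rewrite in_itv/= => /andP[z0 _]; exact: is_derive_arctanp.
have Ix : x \in `]0, (x + y)[ by rewrite in_itv/= x0 ltrDl.
have Iy : y \in `]0, (x + y)[ by rewrite in_itv/= y0 ltrDr.
suff h : {in `]0, (x + y)[ &, {homo (fun z => (1 + z `^ p)^-1) : u v /~ u <= v}}.
  exact: amean_le_of_nincr_derive df h Ix Iy.
move=> u v; rewrite !in_itv/= => _ /andP[v0 _] vu.
by rewrite lef_pV2 ?posrE ?oneDpowR_gt0// (oneDpowR_le p0 (ltW v0) vu).
Qed.

Theorem theorem1p6 (R : realType) (p : R) (hp : 1 < p) :
  [/\ (forall x y : R, 0 < x < pip p / 2 -> 0 < y < pip p / 2 ->
         lmean (1 / sinp p x) (1 / sinp p y) >= 1 / sinp p (amean x y)),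
      (forall x y : R, 0 < x < pip p / 2 -> 0 < y < pip p / 2 ->
         lmean (1 / cosp p x) (1 / cosp p y) >= 1 / cosp p (lmean x y)),
      (forall x y : R, 0 < x -> 0 < y ->
         lmean (tanhp p x) (tanhp p y) <= tanhp p (amean x y)),
      (forall x y : R, 0 < x < 1 -> 0 < y < 1 ->
         lmean (arcsinhp p x) (arcsinhp p y) <= arcsinhp p (amean x y)) &
      (forall x y : R, 0 < x < 1 -> 0 < y < 1 ->
         lmean (arctanp p x) (arctanp p y) <= arctanp p (amean x y))].
Proof.
have p0 : 0 < p := lt_trans ltr01 hp; split => x y.
- exact: lmean_sinp.
- exact: lmean_cosp.
- move=> x0 y0.
  exact: le_trans (lmean_le_amean (tanhp_gt0 hp x0) (tanhp_gt0 hp y0))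
    (tanhp_concave hp x0 y0).
- move=> /andP[x0 _] /andP[y0 _].
  exact: le_trans (lmean_le_amean (arcsinhp_gt0 p0 x0) (arcsinhp_gt0 p0 y0))
    (arcsinhp_concave p0 x0 y0).
- move=> /andP[x0 _] /andP[y0 _].
  exact: le_trans (lmean_le_amean (arctanp_gt0 p x0) (arctanp_gt0 p y0))
    (arctanp_concave p0 x0 y0).
Qed.
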